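(* Consider a solution of a mirror system of four particles (as defined in the context) with $\Delta=\mathcal{E}^2-\mu\ge 0$. Then the solution does not collapse, i.e. it does not have infinitely many collisions in finite time: every bounded time interval contains only finitely many collisions.
   Context: Units are such that the speed of light is $1$. A particle on the real line has energy $E\in\mathbb{R}\setminus\{0\}$, momentum $P\in\mathbb{R}$, velocity $v=P/E$ and squared mass $E^2-P^2$; energies may have either sign. For each particle put $\sigma=E+P$ and $\rho=E-P$. Between collisions particles move with constant velocity. When particles $i,j$ with $v_i\ne v_j$ collide, put $s=\sigma_i+\sigma_j$, $r=\rho_i+\rho_j$; provided $sr\neq0$, the post-collision values are $\sigma_i'=\rho_i s/r$, $\rho_i'=\sigma_i r/s$, $\sigma_j'=\rho_j s/r$, $\rho_j'=\sigma_j r/s$ (total energy, total momentum and each squared mass are preserved). A mirror system consists of four particles with positions $x_1\le x_2\le x_3\le x_4$ such that at all times $x_1=-x_4$, $x_2=-x_3$, $E_1=E_4$, $P_1=-P_4$, $E_2=E_3$, $P_2=-P_3$; the squared masses are $\mu_1=\mu_4=\mu>0$ and $\mu_2=\mu_3=0$. Collisions of the pair 1-2 are simultaneous with those of the pair 3-4; particles 2 and 3 collide only at the origin, where they exchange their energies and momenta (so $E_2$ is unchanged and $P_2$ changes sign). The quantity $\mathcal{E}=E_1+E_2$ is a constant of the motion, and $\Delta=\mathcal{E}^2-\mu$. Solutions are assumed to be such that every collision, in the future and in the past, can be resolved by the collision rule $\sigma_i'=\rho_i s/r$, $\rho_i'=\sigma_i r/s$, $\sigma_j'=\rho_j s/r$,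 $\rho_j'=\sigma_j r/s$ ($sr\ne0$), and there are no multiple collisions at the same time and point (in particular $x_1<0$). A solution collapses if it has infinitely many collisions in finite time. *)

(* Defs.v *)
From HB Require Import structures.
From mathcomp Require Import all_boot all_order all_algebra.
From mathcomp Require Import all_classical all_reals all_analysis.
Set Implicit Arguments.
Unset Strict Implicit.
Unset Printing Implicit Defensive.
Import Order.TTheory GRing.Theory Num.Theory.
Import numFieldNormedType.Exports.
Local Open Scope classical_set_scope.
Local Open Scope ring_scope.

(* Only the values at times in the time domain of a solution (see [solution])
   are meaningful.  At a collision time, [energy] and [momentum] hold the
   post-collision values; the pre-collision values are those at nearby earlier
   times. *)
Record motion (R : realType) (n : nat) := Motion {
  pos : 'I_n -> R -> R;
  energy : 'I_n -> R -> R;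
  momentum : 'I_n -> R -> R }.

Section Dynamics.
Variables (R : realType) (n : nat).
Implicit Types (m : motion R n) (i j k : 'I_n) (t : R) (J : set R).

Definition velocity m i t : R := momentum m i t / energy m i t.
Definition sqmass m i t : R := energy m i t ^+ 2 - momentum m i t ^+ 2.
Definition sigma m i t : R := energy m i t + momentum m i t.
Definition rho m i t : R := energy m i t - momentum m i t.

(* The position formula also covers the right endpoint [b], at which energy and
   momentum may already have jumped. *)
Definition free m i (a b : R) : Prop :=
  (forall t, a <= t < b ->
     energy m i t = energy m i a /\ momentum m i t = momentum m i a) /\
  (forall t, a <= t <= b -> pos m i t = pos m i a + velocity m i a * (t - a)).

(* The velocities that have to differ are the incoming ones. *)
Definition collide m i j t : Prop :=
  [/\ i <> j, pos m i t = pos m j t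
    & \forall s \near t^'-, velocity m i s <> velocity m j s].

Definition collision_rule m i j (t0 t1 : R) : Prop :=
  let s := sigma m i t0 + sigma m j t0 in
  let r := rho m i t0 + rho m j t0 in
  [/\ s * r != 0,
      sigma m i t1 = rho m i t0 * s / r /\ rho m i t1 = sigma m i t0 * r / s
    & sigma m j t1 = rho m j t0 * s / r /\ rho m j t1 = sigma m j t0 * r / s].

(* The time domain [J] is an arbitrary open interval, because a solution cannot
   be continued by the collision rule through a time at which collisions
   accumulate: such a time can only be an endpoint of [J]. *)
Record solution J m : Prop := Solution {
  sol_open : open J;
  sol_interval : is_interval J;
  sol_energy_neq0 : forall i t, J t -> energy m i t != 0;
  sol_free : forall i t, J t ->
    (\forall s \near t^'-, free m i s t) /\ (\forall s \near t^'+, free m i t s);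
  sol_no_collision : forall i t, J t -> (forall j, ~ collide m i j t) ->
    \forall s \near t^'-,
      energy m i t = energy m i s /\ momentum m i t = momentum m i s;
  sol_collision : forall i j t, J t -> collide m i j t ->
    \forall s \near t^'-, collision_rule m i j s t;
  sol_no_multiple : forall i j k t, J t ->
    collide m i j t -> collide m i k t -> j = k }.

Definition collision_times J m : set R :=
  [set t | J t /\ exists i j, collide m i j t].

Definition collapses J m : Prop :=
  exists a b : R, infinite_set (collision_times J m `&` `[a, b]).

End Dynamics.

Definition p1 : 'I_4 := @Ordinal 4 0 isT.
Definition p2 : 'I_4 := @Ordinal 4 1 isT.
Definition p3 : 'I_4 := @Ordinal 4 2 isT.
Definition p4 : 'I_4 := @Ordinal 4 3 isT.

(* By these symmetries a 1-2 collision is simultaneous with a 3-4 collision and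
   a 2-3 collision takes place at the origin; for the latter s = r, so that
   [collision_rule] exchanges the energies and momenta of particles 2 and 3. *)
Record mirror (R : realType) (mu : R) (J : set R) (m : motion R 4) : Prop :=
  Mirror {
  mirror_order : forall t, J t ->
    [/\ pos m p1 t <= pos m p2 t, pos m p2 t <= pos m p3 t
      & pos m p3 t <= pos m p4 t];
  mirror_pos : forall t, J t ->
    pos m p1 t = - pos m p4 t /\ pos m p2 t = - pos m p3 t;
  mirror_energy : forall t, J t ->
    energy m p1 t = energy m p4 t /\ energy m p2 t = energy m p3 t;
  mirror_momentum : forall t, J t ->
    momentum m p1 t = - momentum m p4 t /\ momentum m p2 t = - momentum m p3 t;
  mirror_mu_gt0 : 0 < mu;
  mirror_sqmass14 : forall t, J t -> sqmass m p1 t = mu /\ sqmass m p4 t = mu;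
  mirror_sqmass23 : forall t, J t -> sqmass m p2 t = 0 /\ sqmass m p3 t = 0 }.

Definition half_energy (R : realType) (m : motion R 4) (t : R) : R :=
  energy m p1 t + energy m p2 t.

(* Main.v *)
Require Import Defs.
From mathcomp Require Import all_boot all_order all_algebra.
From mathcomp Require Import all_classical all_reals all_analysis.
From mathcomp Require Import ring lra.
Set Implicit Arguments.
Unset Strict Implicit.
Unset Printing Implicit Defensive.
Import Order.TTheory GRing.Theory Num.Theory.
Import numFieldNormedType.Exports.
Local Open Scope classical_set_scope.
Local Open Scope ring_scope.

(** By symmetry only particles 1 and 2 on the half line x <= 0 matter; particle 2
    is massless and reflects at the origin.  Both the half energy E = E1 + E2 and
    K = E1 E2 x1 - P1 P2 x2 are constants of the motion: K is preserved by free
    flight because P2 ^ 2 = E2 ^ 2, by a reflection because x2 = 0 there, and by a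
    1-2 collision because then x1 = x2 and the Minkowski product E1 E2 - P1 P2 is
    preserved.  Since |P1| < |E1|, |P2| = |E2| and x1 <= x2 <= 0, x1 < 0, we have
    K <> 0.  If rho and sigma = mu / rho belong to particle 1 just after a 1-2
    collision at -d, the next 1-2 collision takes place at -d rho / sigma, a time
    T = d (1 + rho / sigma) later, while K = d ((rho ^ 2 + mu) / 2 - rho E).
    Hence |K| <= (|E| (1 + mu) + mu) T, which bounds T from below uniformly.
    Two consecutive reflections are separated by a 1-2 collision, so any three
    reflections span at least the same time. *)

(** * Local-to-global passage and sparse sets on the real line *)

Section RealLine.
Variable R : realType.
Implicit Types (t : R) (J A : set R).

Lemma at_left_interval t (P : set R) :
  (\forall s \near t^'-, P s) <->
  exists2 e, 0 < e & forall s, t - e < s < t -> P s.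
Proof.
split=> [/nbhs_ballP[e /= e0 Pe]|[e e0 Pe]].
  exists e => // s /andP[ts st]; apply: Pe => //=.
  by rewrite /ball /= gtr0_norm ?subr_gt0// ltrBlDr addrC -ltrBlDr.
near=> s; apply: Pe; apply/andP; split=> //; near: s.
by apply: nbhs_left_gt; rewrite ltrBlDr ltrDl.
Unshelve. all: by end_near. Qed.

Lemma at_right_interval t (P : set R) :
  (\forall s \near t^'+, P s) <->
  exists2 e, 0 < e & forall s, t < s < t + e -> P s.
Proof.
split=> [/nbhs_ballP[e /= e0 Pe]|[e e0 Pe]].
  exists e => // s /andP[ts st]; apply: Pe => //=.
  by rewrite /ball /= ltr0_norm ?subr_lt0// opprB ltrBlDr addrC.
near=> s; apply: Pe; apply/andP; split=> //; near: s.
by apply: nbhs_right_lt; rewrite ltrDl.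
Unshelve. all: by end_near. Qed.

(** Real induction: let [c] be the supremum of the [u] in [[s, t]] with [r s u]. The left condition
    puts [c] itself in this set, and the right condition would lead beyond [c] if [c < t]. *)
Lemma local_preorder J (r : R -> R -> Prop) :
  is_interval J ->
  (forall t, J t -> r t t) ->
  (forall s t u, J s -> J t -> J u -> s <= t -> t <= u ->
     r s t -> r t u -> r s u) ->
  (forall t, J t -> \forall s \near t^'-, r s t) ->
  (forall t, J t -> \forall s \near t^'+, r t s) ->
  forall s t, J s -> J t -> s <= t -> r s t.
Proof.
move=> Jint rxx rtrans rleft rright s t Js Jt st.
pose A := [set u | s <= u <= t /\ r s u].
have As : A s by rewrite /A /= lexx st; split => //; exact: rxx.
have Asup : has_sup A by split; [exists s|exists t => u [/andP[]]].
set c := sup A.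
have sc : s <= c by apply: ub_le_sup => //; case: Asup.
have ct : c <= t by apply: ge_sup; [exists s|move=> u [/andP[]]].
have Jst u : s <= u <= t -> J u by exact: Jint.
have Jc : J c by apply: Jst; rewrite sc ct.
have rsc : r s c.
  have [e e0 re] := (at_left_interval _ _).1 (rleft _ Jc).
  have [u [/andP[su ut] rsu] cu] := sup_adherent e0 Asup.
  have : u <= c by apply: ub_le_sup; [case: Asup|split; rewrite ?su].
  rewrite le_eqVlt => /predU1P[<-//|uc].
  apply: (rtrans _ u) => //; [by apply: Jst; rewrite su|exact: ltW|].
  by apply: re; rewrite cu.
move: ct; rewrite le_eqVlt => /predU1P[<-//|ct].
have [e e0 re] := (at_right_interval _ _).1 (rright _ Jc).
pose w := Num.min t (c + e / 2).
have cw : c < w by rewrite lt_min ct ltrDl divr_gt0.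
have wt : w <= t by rewrite ge_min lexx.
have wce : w < c + e.
  by rewrite gt_min ltrD2l ltr_pdivrMr// ltr_pMr// ltrDl ltr01 orbT.
have sw : s <= w by rewrite (le_trans sc)// ltW.
have : w <= c.
  apply: ub_le_sup; first by case: Asup.
  split; first by rewrite sw.
  apply: (rtrans _ c) => //; [by apply: Jst; rewrite sw|exact: ltW|].
  by apply: re; rewrite cw.
by rewrite leNgt cw.
Qed.

(** A half-open window of length [delta] holds at most two points of [A]. The hypothesis is about
    three points because the gap bound for reflections spans three of them. *)
Lemma finite_set_sparse A (delta a b : R) : 0 < delta ->
  (forall t u w, A t -> A u -> A w -> t < u -> u < w -> t + delta <= w) ->
  finite_set (A `&` `[a, b]).
Proof.
move=> delta0 gapA.
have fin1 c : finite_set (A `&` `[c, c + delta[).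
  set B := A `&` _.
  have B3 t u w : B t -> B u -> B w -> t < u -> u < w -> False.
    move=> [At /=]; rewrite in_itv/= => /andP[ct _] [Au _] [Aw /=].
    rewrite in_itv/= => /andP[_ wc] tu uw.
    have := gapA _ _ _ At Au Aw tu uw; rewrite leNgt => /negP; apply.
    by rewrite (lt_le_trans wc)// lerD2r.
  have [[u Bu]|B0] := pselect (B !=set0); last first.
    rewrite (_ : B = set0) //; apply/seteqP; split => // x Bx.
    by case: B0; exists x.
  have [[v [Bv vu]]|Bv] := pselect (exists v, B v /\ v <> u); last first.
    apply: (sub_finite_set _ (finite_set1 u)) => x Bx /=.
    by apply: contrapT => xu; apply: Bv; exists x.
  apply: (sub_finite_set _ (finite_set2 u v)) => x Bx /=.
  apply: contrapT => /not_orP[xu xv].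
  wlog uv : u v Bu Bv vu xu xv / u < v.
    move=> H; have [uv|uv|uv] := ltgtP u v; [exact: (H u v)| |by apply: vu].
    by apply: (H v u) => //; apply/nesym.
  have [ux|xu'|ux] := ltgtP u x; [|exact: (B3 x u v)|exact/xu/esym].
  have [vx|xv'|vx] := ltgtP v x;
    [exact: (B3 u v x)|exact: (B3 u x v)|exact/xv/esym].
have fin n : finite_set (A `&` `[a, a + n%:R * delta[).
  elim: n => [|n IHn].
    rewrite mul0r addr0 set_itvco0 ?setI0 //.
  have : finite_set ((A `&` `[a, a + n%:R * delta[) `|`
      (A `&` `[a + n%:R * delta, a + n%:R * delta + delta[)).
    by rewrite finite_setU; split.
  apply: sub_finite_set => x [Ax] /=; rewrite !in_itv/= => /andP[ax xa].
  have [xn|nx] := ltP x (a + n%:R * delta); [left|right]; split => //=.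
    by rewrite ax.
  by rewrite (lt_le_trans xa)// -addrA lerD2l -natr1 mulrDl mul1r.
(* This many windows of length [delta], laid from [a] onwards, reach beyond [b]. *)
apply: (sub_finite_set _ (fin (Num.bound ((b - a) / delta)))) => x [Ax] /=.
rewrite !in_itv/= => /andP[ax xb]; split => //=; rewrite ax/=.
rewrite (le_lt_trans xb)// -ltrBlDl -ltr_pdivrMr//.
exact: unstable.ltr_bound.
Qed.

End RealLine.

(** * Algebra of a single 1-2 collision *)

(** As sigma_2 = 0 before the collision, [s] is sigma_1, whence sigma_1' = mu / r and rho_1' = r.
    The last conclusion is the conservation of E1 E2 - P1 P2, which is E2 (E1 + P1) before and E2'
    (E1' - P1') after. *)
Lemma massless_from_right_collision (R : realType)
    (mu E1 P1 E2 P2 E1' P1' E2' P2' : R) :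
  E1 ^+ 2 - P1 ^+ 2 = mu -> P2 = - E2 ->
  let s := (E1 + P1) + (E2 + P2) in
  let r := (E1 - P1) + (E2 - P2) in
  [/\ s * r != 0,
     E1' + P1' = (E1 - P1) * s / r /\ E1' - P1' = (E1 + P1) * r / s
    & E2' + P2' = (E2 - P2) * s / r /\ E2' - P2' = (E2 + P2) * r / s] ->
  [/\ P2' = E2', E1' + E2' = E1 + E2,
     E1' - P1' = r &
     E2' * r = E2 * (E1 + P1)].
Proof.
move=> M1 -> s r [].
rewrite mulf_eq0 negb_or => /andP[s0 r0] [h1 h2] [h3 h4].
have sE : s = E1 + P1 by rewrite /s; ring.
have rE : r = E1 - P1 + 2 * E2 by rewrite /r; ring.
have h2' : E1' - P1' = r by rewrite h2 -sE; field.
have h1' : E1' + P1' = mu / r by rewrite h1 sE -M1; congr (_ / _); ring.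
have h4' : P2' = E2'.
  by apply/eqP; rewrite eq_sym -subr_eq0 h4 subrr !mul0r.
have h5 : E2' * r = E2 * (E1 + P1).
  apply: (@mulfI _ 2%:R); first by rewrite pnatr_eq0.
  have -> : 2 * (E2' * r) = (E2' + P2') * r by rewrite h4'; ring.
  rewrite h3 sE; field. done.
split => //.
apply: (@mulIf _ r) => //.
rewrite mulrDl h5.
have : (E1' + P1') * r = mu by rewrite h1' mulfVK.
have : (E1' - P1') * r = r * r by rewrite h2'.
rewrite -M1 => b a.
have -> : E1' * r = E1 * r + E2 * r - E2 * (E1 + P1).
  apply: (@mulfI _ 2%:R); first by rewrite pnatr_eq0.
  have -> : 2 * (E1' * r) = (E1' + P1') * r + (E1' - P1') * r by ring.
  rewrite a b rE; ring.
ring.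
Qed.

(** Since sigma = mu / rho, the factor rho / sigma + 1 is (rho^2 + mu) / mu. The term rho e is
    absorbed through |rho| mu <= (rho^2 + mu^2) / 2. *)
Lemma collision_gap_bound (R : realFieldType) (mu e rho sigma d : R) :
  0 < mu -> rho * sigma = mu -> 0 <= d ->
  `|d * ((rho ^+ 2 + mu) / 2 - rho * e)|
    <= (`|e| * (1 + mu) + mu) * (d * (rho / sigma + 1)).
Proof.
move=> mu0 rs d0.
have rho0 : rho != 0 by apply/eqP => h; move: mu0; rewrite -rs h mul0r ltxx.
have -> : rho / sigma + 1 = (rho ^+ 2 + mu) / mu.
  by rewrite -rs; field; apply/andP; split=> //; apply/eqP => h;
    move: mu0; rewrite -rs h mulr0 ltxx.
rewrite normrM (ger0_norm d0) mulrCA ler_wpM2l// mulrA ler_pdivlMr//.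
have q0 : 0 <= rho ^+ 2 + mu by nra.
have h1 : `|rho| * mu <= (1 + mu) * (rho ^+ 2 + mu).
  rewrite -(real_normK (num_real rho)); have a0 := normr_ge0 rho.
  have := sqr_ge0 (`|rho| - mu); have := mulr_ge0 (ltW mu0) (sqr_ge0 `|rho|); nra.
have h2 : `|(rho ^+ 2 + mu) / 2 - rho * e|
    <= (rho ^+ 2 + mu) / 2 + `|rho| * `|e|.
  rewrite (le_trans (ler_normB _ _))// (normrM rho).
  by rewrite (ger0_norm (divr_ge0 q0 (ler0n _ 2))).
have h3 : `|rho| * `|e| * mu <= `|e| * ((1 + mu) * (rho ^+ 2 + mu)).
  by rewrite mulrAC mulrC ler_wpM2l.
have h4 := ler_wpM2r (ltW mu0) h2.
rewrite (le_trans h4)// mulrDl. nra.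
Qed.

(** * Collisions of the mirror system in terms of positions *)

Section Mirror.
Variables (R : realType) (mu : R) (J : set R) (m : motion R 4).
Hypotheses (m_solution : solution J m) (m_mirror : mirror mu J m).

Let mu_gt0 : 0 < mu := mirror_mu_gt0 m_mirror.

Lemma ord4P (j : 'I_4) : [\/ j = p1, j = p2, j = p3 | j = p4].
Proof.
case: j => [[|[|[|[|//]]]] jP]; [apply: Or41|apply: Or42|apply: Or43|apply: Or44];
  exact: val_inj.
Qed.

Lemma mirror_near_left t : J t -> \forall s \near t^'-, J s.
Proof.
by move=> Jt; apply: cvg_within; apply: open_nbhs_nbhs; split => //; case: m_solution.
Qed.

Lemma mirror_near_right t : J t -> \forall s \near t^'+, J s.
Proof.
by move=> Jt; apply: cvg_within; apply: open_nbhs_nbhs; split => //; case: m_solution.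
Qed.

Lemma mirror_velocity2 t : J t -> velocity m p2 t ^+ 2 = 1.
Proof.
move=> Jt; have [+ _] := mirror_sqmass23 m_mirror Jt.
have := sol_energy_neq0 m_solution p2 Jt.
rewrite /velocity /sqmass => E0 M; rewrite expr_div_n.
have -> : momentum m p2 t ^+ 2 = energy m p2 t ^+ 2 by apply/esym/subr0_eq.
by rewrite divff// expf_neq0.
Qed.

Lemma mirror_velocity1 t : J t -> velocity m p1 t ^+ 2 < 1.
Proof.
move=> Jt; have [+ _] := mirror_sqmass14 m_mirror Jt.
have := sol_energy_neq0 m_solution p1 Jt.
rewrite /velocity /sqmass => E0 M; rewrite expr_div_n.
rewrite ltr_pdivrMr ?mul1r ?exprn_even_gt0//.
by rewrite -subr_gt0 M.
Qed.

Lemma mirror_velocity3 t : J t -> velocity m p3 t = - velocity m p2 t.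
Proof.
move=> Jt; rewrite /velocity.
have [_ ->] := mirror_energy m_mirror Jt.
by have [_ ->] := mirror_momentum m_mirror Jt; rewrite mulNr opprK.
Qed.

(** Meeting suffices: the massive particle is slower than light and the massless one is not. *)
Lemma collide12 t : J t -> pos m p1 t = pos m p2 t -> collide m p1 p2 t.
Proof.
move=> Jt x12; split => //; near=> s.
have Js : J s by near: s; exact: mirror_near_left.
move=> v12; have := mirror_velocity1 Js.
by rewrite v12 mirror_velocity2// ltxx.
Unshelve. all: by end_near. Qed.

Lemma collide13 t : J t -> pos m p1 t = pos m p3 t -> collide m p1 p3 t.
Proof.
move=> Jt x13; split => //; near=> s.
have Js : J s by near: s; exact: mirror_near_left.
move=> v13; have := mirror_velocity1 Js.
by rewrite v13 mirror_velocity3// sqrrN mirror_velocity2// ltxx.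
Unshelve. all: by end_near. Qed.

Lemma collide23 t : J t -> pos m p2 t = 0 -> collide m p2 p3 t.
Proof.
move=> Jt x2; split => //.
  by have [_] := mirror_pos m_mirror Jt; rewrite x2 => /eqP; rewrite eq_sym oppr_eq0 => /eqP.
near=> s.
have Js : J s by near: s; exact: mirror_near_left.
have := mirror_velocity2 Js; rewrite mirror_velocity3// => v2 vN.
move: v2; have -> : velocity m p2 s = 0 by lra.
by rewrite expr0n => /eqP; rewrite eq_sym oner_eq0.
Unshelve. all: by end_near. Qed.

Lemma pos2_le0 t : J t -> pos m p2 t <= 0.
Proof.
move=> Jt; have [_ h _] := mirror_order m_mirror Jt.
have [_] := mirror_pos m_mirror Jt; lra.
Qed.

(** Otherwise order and symmetry put all four particles at the origin, where particle 1 would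
    collide with both 2 and 3. *)
Lemma pos1_lt0 t : J t -> pos m p1 t < 0.
Proof.
move=> Jt; have [h1 h2 h3] := mirror_order m_mirror Jt.
have [h4 h5] := mirror_pos m_mirror Jt.
rewrite ltNge; apply/negP => h6.
have c12 : collide m p1 p2 t by apply: collide12 => //; lra.
have c13 : collide m p1 p3 t by apply: collide13 => //; lra.
by have := sol_no_multiple m_solution Jt c12 c13.
Qed.

Lemma collision_timesP t : collision_times J m t ->
  J t /\ (pos m p1 t = pos m p2 t \/ pos m p2 t = 0).
Proof.
move=> [Jt [i [j [ij xij _]]]]; split => //.
have [h1 h2 h3] := mirror_order m_mirror Jt.
have [h4 h5] := mirror_pos m_mirror Jt.
have [x12|x12] := eqVneq (pos m p1 t) (pos m p2 t); first by left.
have [x2|x2] := eqVneq (pos m p2 t) 0; first by right.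
have {}x12 : pos m p1 t < pos m p2 t by rewrite lt_neqAle x12.
have {}x2 : pos m p2 t < 0 by rewrite lt_neqAle x2 pos2_le0.
(* From x1 < x2 < 0 the symmetry makes all four positions distinct. *)
exfalso; case: (ord4P i) ij xij => ->; case: (ord4P j) => -> // _; lra.
Qed.

(** * Quantities constant in flight, and their behaviour at a collision *)

(* Distance from the origin and time of the next 1-2 collision, if there is one;
   at a 1-2 collision time, of the one after it. *)
Definition next_reach t :=
  (momentum m p1 t * velocity m p2 t * pos m p2 t - energy m p1 t * pos m p1 t)
    / sigma m p1 t.

Definition next_time t := t + next_reach t - velocity m p2 t * pos m p2 t.

(** The constant K. For nonzero E2 and sigma_1 it equals - E2 sigma_1 times [next_reach]; when x1 =
    x2 it is x1 times the Minkowski product of the two energy-momentum vectors. *)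
Definition minkowski t :=
  energy m p1 t * energy m p2 t * pos m p1 t
  - momentum m p1 t * momentum m p2 t * pos m p2 t.

Definition same_state s t :=
  [/\ next_time s = next_time t, next_reach s = next_reach t,
      half_energy m s = half_energy m t & minkowski s = minkowski t].

(** As v2^2 = 1, the product v2 x2 grows with slope 1, like a clock reading 0 at the reflection,
    while E1 x1 grows with slope P1; so the numerator of [next_reach] is constant. The second
    alternative for the momentum admits a reflection at time [t], where x2 = 0 hides the sign of
    P2. *)
Lemma flight_same_state s t : J s -> J t ->
  energy m p1 s = energy m p1 t -> momentum m p1 s = momentum m p1 t ->
  energy m p2 s = energy m p2 t ->
  momentum m p2 s = momentum m p2 t \/
    momentum m p2 s = - momentum m p2 t /\ pos m p2 t = 0 ->
  pos m p1 t = pos m p1 s + velocity m p1 s * (t - s) ->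
  pos m p2 t = pos m p2 s + velocity m p2 s * (t - s) ->
  same_state s t.
Proof.
move=> Js Jt E1 P1 E2 P2 x1 x2.
have v2 := mirror_velocity2 Js.
have E10 := sol_energy_neq0 m_solution p1 Js.
have E20 := sol_energy_neq0 m_solution p2 Js.
have x1E : energy m p1 s * pos m p1 t =
    energy m p1 s * pos m p1 s + momentum m p1 s * (t - s).
  by rewrite x1 /velocity; field.
have P2v : momentum m p2 s = energy m p2 s * velocity m p2 s.
  by rewrite /velocity mulrCA divff// mulr1.
have v2x2 : velocity m p2 s * pos m p2 t = velocity m p2 t * pos m p2 t.
  by rewrite /velocity E2; case: P2 => [->//|[_ ->]]; rewrite !mulr0.
have v2x2' : velocity m p2 t * pos m p2 t =
    velocity m p2 s * pos m p2 s + (t - s).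
  by rewrite -v2x2 x2 mulrDr mulrA -expr2 v2 mul1r.
have P2x2 : momentum m p2 t * pos m p2 t = momentum m p2 s * pos m p2 t.
  by case: P2 => [->//|[_ ->]]; rewrite !mulr0.
have reach : next_reach s = next_reach t.
  rewrite /next_reach /sigma -E1 -P1; congr (_ / _).
  by rewrite x1E -(mulrA _ _ (pos m p2 t)) v2x2'; ring.
split => //.
- by rewrite /next_time reach v2x2'; ring.
- by rewrite /half_energy E1 E2.
- rewrite /minkowski -E1 -P1 -E2 (mulrAC _ _ (pos m p1 t)) x1E
    -(mulrA _ _ (pos m p2 t)) P2x2.
  have -> : momentum m p2 s * pos m p2 t = energy m p2 s * (velocity m p2 t * pos m p2 t).
    by rewrite P2v -mulrA v2x2.
  by rewrite v2x2' P2v; ring.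
Qed.

Lemma near_right_same_state t : J t -> \forall s \near t^'+, same_state t s.
Proof.
move=> Jt.
have [e1 e10 free1] := (at_right_interval _ _).1 (sol_free m_solution p1 Jt).2.
have [e2 e20 free2] := (at_right_interval _ _).1 (sol_free m_solution p2 Jt).2.
have [e3 e30 Jr] := (at_right_interval _ _).1 (mirror_near_right Jt).
pose e := Num.min e1 (Num.min e2 e3).
have e0 : 0 < e by rewrite !lt_min e10 e20.
have [ee1 ee2 ee3] : [/\ e <= e1, e <= e2 & e <= e3].
  by rewrite !ge_min !lexx !orbT.
(* Energy and momentum may jump at the right end of a [free] interval, so one interval up to
   [t + e / 2] is fixed and [s] stays strictly before its end. *)
apply/at_right_interval; exists (e / 2); first by rewrite divr_gt0.
move=> s /andP[ts se].
have tse : t < t + e / 2 by rewrite ltrDl divr_gt0.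
have [h1 h1'] : Defs.free m p1 t (t + e / 2) by apply: free1; apply/andP; split; lra.
have [h2 h2'] : Defs.free m p2 t (t + e / 2) by apply: free2; apply/andP; split; lra.
have tst : t <= s < t + e / 2 by rewrite ltW.
have tst' : t <= s <= t + e / 2 by rewrite ltW//= ltW.
have [E1 P1] := h1 _ tst; have [E2 P2] := h2 _ tst.
apply: flight_same_state; rewrite ?E1 ?P1 ?E2 ?P2 -?h1' -?h2' //; last by left.
by apply: Jr; apply/andP; split; lra.
Qed.

Lemma no_collide1 t j : J t -> pos m p1 t != pos m p2 t -> ~ collide m p1 j t.
Proof.
move=> Jt x12 [ij xij _].
have [h1 h2 h3] := mirror_order m_mirror Jt.
have {}x12 : pos m p1 t < pos m p2 t by rewrite lt_neqAle x12.
case: (ord4P j) ij xij => -> //; lra.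
Qed.

Lemma no_collide2 t j : J t -> pos m p1 t != pos m p2 t -> pos m p2 t != 0 ->
  ~ collide m p2 j t.
Proof.
move=> Jt x12 x2 [ij xij _].
have [h1 h2 h3] := mirror_order m_mirror Jt.
have [h4 h5] := mirror_pos m_mirror Jt.
have {}x12 : pos m p1 t < pos m p2 t by rewrite lt_neqAle x12.
have {}x2 : pos m p2 t < 0 by rewrite lt_neqAle x2 pos2_le0.
case: (ord4P j) ij xij => -> //; lra.
Qed.

(** Only a reflection can affect particle 2 here. By symmetry it has s = r = 2 E2, so the rule swaps
    sigma and rho, which flips the sign of P2. *)
Lemma near_left_particle2 t : J t -> pos m p1 t != pos m p2 t ->
  \forall s \near t^'-, energy m p2 s = energy m p2 t /\
    (momentum m p2 s = momentum m p2 t \/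
     momentum m p2 s = - momentum m p2 t /\ pos m p2 t = 0).
Proof.
move=> Jt x12; have [x20|x20] := eqVneq (pos m p2 t) 0; last first.
  have no2 j := @no_collide2 t j Jt x12 x20.
  near=> s.
  have [-> ->] : energy m p2 t = energy m p2 s /\ momentum m p2 t = momentum m p2 s.
    by near: s; exact: (sol_no_collision m_solution Jt no2).
  by split => //; left.
near=> s.
have Js : J s by near: s; exact: mirror_near_left.
have [] : collision_rule m p2 p3 s t.
  by near: s; apply: (sol_collision m_solution Jt); exact: collide23.
have [_ E3] := mirror_energy m_mirror Js.
have [_ P3] := mirror_momentum m_mirror Js.
have -> : rho m p2 s + rho m p3 s = 2 * energy m p2 s.
  by rewrite /rho -E3; move: P3; lra.
have -> : sigma m p2 s + sigma m p3 s = 2 * energy m p2 s.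
  by rewrite /sigma -E3; move: P3; lra.
rewrite mulf_eq0 orbb => E20 [].
rewrite !mulfK// /sigma /rho => h1 h2 _.
by split; [|right; split => //]; lra.
Unshelve. all: by end_near. Qed.

Lemma near_left_same_state t : J t -> pos m p1 t != pos m p2 t ->
  \forall s \near t^'-, same_state s t.
Proof.
move=> Jt x12; near=> s.
have st : s < t by near: s; exact: nbhs_left_lt.
have Js : J s by near: s; exact: mirror_near_left.
have [_ f1] : Defs.free m p1 s t by near: s; exact: (sol_free m_solution p1 Jt).1.
have [_ f2] : Defs.free m p2 s t by near: s; exact: (sol_free m_solution p2 Jt).1.
have [E1 P1] : energy m p1 t = energy m p1 s /\ momentum m p1 t = momentum m p1 s.
  near: s; apply: (sol_no_collision m_solution Jt) => j.
  exact: no_collide1.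
have [E2 P2] : energy m p2 s = energy m p2 t /\
    (momentum m p2 s = momentum m p2 t \/
     momentum m p2 s = - momentum m p2 t /\ pos m p2 t = 0).
  by near: s; exact: near_left_particle2.
apply: flight_same_state => //; [apply: f1|apply: f2]; by rewrite ltW/=.
Unshelve. all: by end_near. Qed.

Lemma near_left_collision12 t : J t -> pos m p1 t = pos m p2 t ->
  \forall s \near t^'-, [/\ next_time s = t, velocity m p2 t = 1,
     half_energy m s = half_energy m t & minkowski s = minkowski t].
Proof.
move=> Jt x12; near=> s.
have st : s < t by near: s; exact: nbhs_left_lt.
have Js : J s by near: s; exact: mirror_near_left.
have [_ f1] : Defs.free m p1 s t by near: s; exact: (sol_free m_solution p1 Jt).1.
have [_ f2] : Defs.free m p2 s t by near: s; exact: (sol_free m_solution p2 Jt).1.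
have x1 : pos m p1 t = pos m p1 s + velocity m p1 s * (t - s).
  by apply: f1; rewrite ltW/=.
have x2 : pos m p2 t = pos m p2 s + velocity m p2 s * (t - s).
  by apply: f2; rewrite ltW/=.
have rule : collision_rule m p1 p2 s t.
  by near: s; apply: (sol_collision m_solution Jt); exact: collide12.
have E10 := sol_energy_neq0 m_solution p1 Js.
have E20 := sol_energy_neq0 m_solution p2 Js.
have E20' := sol_energy_neq0 m_solution p2 Jt.
have v1 := mirror_velocity1 Js.
(* With velocity 1, particle 2 would outrun particle 1 and, starting from x1 <= x2, they could not
   meet. *)
have v2 : velocity m p2 s = -1.
  have /eqP := mirror_velocity2 Js; rewrite sqrf_eq1 => /orP[]/eqP v2 //.
  have [h _ _] := mirror_order m_mirror Js.
  have : velocity m p1 s < 1 by nra.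
  have := x12; rewrite x1 x2 v2 => x12' v1lt; nra.
have P2 : momentum m p2 s = - energy m p2 s.
  by rewrite -mulN1r -v2 /velocity divfK.
have x1E : energy m p1 s * pos m p1 s =
    energy m p1 s * pos m p1 t - momentum m p1 s * (t - s).
  by rewrite x1 /velocity; field.
have x2E : pos m p2 s = pos m p1 t + (t - s) by rewrite x12 x2 v2; ring.
have [M1 _] := mirror_sqmass14 m_mirror Js.
have [P2' EE R1 L2] := massless_from_right_collision M1 P2 rule.
have sigma0 : energy m p1 s + momentum m p1 s != 0.
  apply/eqP => h; move: mu_gt0; rewrite -M1 /sqmass.
  by rewrite subr_sqr h mulr0 ltxx.
have reach : next_reach s = - pos m p1 t.
  rewrite /next_reach v2 x1E x2E /sigma; field; exact: sigma0.
split.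
- by rewrite /next_time reach v2 x2E; ring.
- by rewrite /velocity P2' divff.
- by rewrite /half_energy EE.
- rewrite /minkowski P2 P2' -x12 x2E (mulrAC _ _ (pos m p1 s)) x1E.
  rewrite -R1 in L2.
  (* The middle term is x1 times the incoming Minkowski product; [L2] turns it into the outgoing
     one. *)
  transitivity (pos m p1 t * (energy m p2 s * (energy m p1 s + momentum m p1 s))).
    ring.
  by rewrite -L2; ring.
Unshelve. all: by end_near. Qed.

(** * Nonvanishing of K and the jump of [next_time] *)

Lemma sigma1_neq0 t : J t -> sigma m p1 t != 0.
Proof.
move=> Jt; apply/eqP => h; move: mu_gt0.
have [<- _] := mirror_sqmass14 m_mirror Jt.
by rewrite /sqmass subr_sqr -/(sigma m p1 t) h mulr0 ltxx.
Qed.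

Lemma minkowski_neq0 t : J t -> minkowski t != 0.
Proof.
move=> Jt; have x1 := pos1_lt0 Jt; have x2 := pos2_le0 Jt.
have [x12 _ _] := mirror_order m_mirror Jt.
have v1 := mirror_velocity1 Jt.
have E10 := sol_energy_neq0 m_solution p1 Jt.
have E20 := sol_energy_neq0 m_solution p2 Jt.
(* Factoring out the energies, whose signs are unknown, leaves x1 - v1 v2 x2 with |v1 v2| < 1 and
   |x2| <= |x1|. *)
have -> : minkowski t = energy m p1 t * energy m p2 t *
    (pos m p1 t - velocity m p1 t * velocity m p2 t * pos m p2 t).
  by rewrite /minkowski /velocity; field; apply/andP; split.
rewrite !mulf_neq0//; apply/eqP => h.
have v1b : -1 < velocity m p1 t < 1 by apply/andP; split; nra.
have /eqP := mirror_velocity2 Jt; rewrite sqrf_eq1 => /orP[]/eqP v2;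
  rewrite v2 in h; case/andP: v1b => ? ?; nra.
Qed.

(** Gives [t <= next_time t] at a reflection. Dividing by E1 turns [next_reach] into - x1 / (1 +
    v1), whatever the sign of E1. *)
Lemma reach_ge0 t : J t -> pos m p2 t = 0 -> 0 <= next_reach t.
Proof.
move=> Jt x2; have x1 := pos1_lt0 Jt.
have v1 := mirror_velocity1 Jt.
have E10 := sol_energy_neq0 m_solution p1 Jt.
have s0 := sigma1_neq0 Jt.
have v1b : 0 < 1 + velocity m p1 t by nra.
have -> : next_reach t = - pos m p1 t / (1 + velocity m p1 t).
  rewrite /next_reach x2 /velocity /sigma; field.
  by rewrite E10 (sol_energy_neq0 m_solution p2) ?andbT//; exact: s0.
by rewrite divr_ge0 ?ltW// oppr_gt0.
Qed.

(** This is [collision_gap_bound] with d = - x1: [next_reach] is then d rho / sigma, and rho^2 + mu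
    = 2 rho E1 brings K into the required form. *)
Lemma collision12_jump t : J t -> pos m p1 t = pos m p2 t -> velocity m p2 t = 1 ->
  `|minkowski t| <= (`|half_energy m t| * (1 + mu) + mu) * (next_time t - t).
Proof.
move=> Jt x12 v2; have x1 := pos1_lt0 Jt.
have s0 := sigma1_neq0 Jt.
have E20 := sol_energy_neq0 m_solution p2 Jt.
have P2 : momentum m p2 t = energy m p2 t.
  by rewrite -[RHS]mul1r -v2 /velocity divfK.
have rs : rho m p1 t * sigma m p1 t = mu.
  by have [<- _] := mirror_sqmass14 m_mirror Jt; rewrite /sqmass subr_sqr.
have d0 : 0 <= - pos m p1 t by rewrite oppr_ge0 ltW.
have := collision_gap_bound (half_energy m t) mu_gt0 rs d0.
congr (`|_| <= _ * _).
  by rewrite -rs /minkowski /half_energy P2 -x12 /rho /sigma; field.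
by rewrite /next_time /next_reach v2 -x12 /rho /sigma; field; exact: s0.
Qed.

Lemma near_left_conserved t : J t -> \forall s \near t^'-,
  half_energy m s = half_energy m t /\ minkowski s = minkowski t.
Proof.
move=> Jt; have [x12|x12] := eqVneq (pos m p1 t) (pos m p2 t).
  by apply: filterS (near_left_collision12 Jt x12) => s [].
by apply: filterS (near_left_same_state Jt x12) => s [].
Qed.

Lemma conserved s t : J s -> J t ->
  half_energy m s = half_energy m t /\ minkowski s = minkowski t.
Proof.
wlog st : s t / s <= t.
  by move=> H Js Jt; case: (leP s t) => [|/ltW] /H [] // -> ->.
move=> Js Jt; move: st; move: Js Jt.
apply: (local_preorder (r := fun s t =>
  half_energy m s = half_energy m t /\ minkowski s = minkowski t)) => //.
- exact: sol_interval m_solution.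
- by move=> {}s {}t u _ _ _ _ _ [-> ->].
- exact: near_left_conserved.
- by move=> u Ju; apply: filterS (near_right_same_state Ju) => w [].
Qed.

(** * Uniform gaps between collisions, and finiteness *)

Section Step.
Variables (t0 : R) (J_t0 : J t0).

(** By [conserved], every time in [J] gives the same value as [t0]. *)
Let delta :=
  `|minkowski t0| / (`|half_energy m t0| * (1 + mu) + mu).

Lemma delta_denom_gt0 : 0 < `|half_energy m t0| * (1 + mu) + mu.
Proof. by rewrite ltr_wpDl// mulr_ge0// addr_ge0// ltW. Qed.

Lemma delta_gt0 : 0 < delta.
Proof. by rewrite divr_gt0 ?delta_denom_gt0// normr_gt0 minkowski_neq0. Qed.

Lemma next_time_jump t : J t -> pos m p1 t = pos m p2 t ->
  t + delta <= next_time t.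
Proof.
move=> Jt x12.
have [s [_ v2 _ _]] := filter_ex (near_left_collision12 Jt x12).
have := collision12_jump Jt x12 v2.
have [-> ->] := conserved Jt J_t0.
by rewrite mulrC -ler_pdivrMr ?delta_denom_gt0// lerBrDl.
Qed.

(* Every 1-2 collision in ]s, t] makes [next_time] jump by at least [delta]; the
   first such collision takes place at [next_time s], hence the clause
   [next_time s <= t].  This relation is transitive, so it can be checked locally. *)
Definition step s t :=
  next_time s = next_time t /\ next_reach s = next_reach t \/
  next_time s <= t /\ next_time s + delta <= next_time t.

Lemma stepP s t : J s -> J t -> s <= t -> step s t.
Proof.
apply: local_preorder.
- exact: sol_interval m_solution.
- by move=> u _; left.
- move=> {}s {}t u _ _ _ st tu.
  have d0 := delta_gt0.
  move=> [[n1 r1]|[n1 n2]] [[n3 r3]|[n3 n4]].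
  + by left; rewrite n1 r1.
  + by right; rewrite n1.
  + by right; rewrite -n3; split => //; exact: le_trans tu.
  + by right; split; lra.
- move=> u Ju; have [x12|x12] := eqVneq (pos m p1 u) (pos m p2 u).
    apply: filterS (near_left_collision12 Ju x12) => s' [n _ _ _].
    by right; rewrite n; split => //; exact: next_time_jump.
  by apply: filterS (near_left_same_state Ju x12) => s' []; left.
- by move=> u Ju; apply: filterS (near_right_same_state Ju) => s' []; left.
Qed.

(** Just before [u] there is [s] with [next_time s = u]. From [t] to [s], either [next_time] has
    kept the value [u], or [next_time t] is at most [s]. *)
Lemma collision12_gap t u : J t -> J u ->
  pos m p1 t = pos m p2 t -> pos m p1 u = pos m p2 u -> t < u -> t + delta <= u.
Proof.
move=> Jt Ju xt xu tu.
apply: (le_trans (next_time_jump Jt xt)).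
near (u^'-) => s.
have su : s < u by near: s; exact: nbhs_left_lt.
have ts : t <= s by rewrite ltW//; near: s; exact: nbhs_left_gt.
have Js : J s by near: s; exact: mirror_near_left.
have [ns _ _ _] : [/\ next_time s = u, velocity m p2 u = 1,
     half_energy m s = half_energy m u & minkowski s = minkowski u].
  by near: s; exact: near_left_collision12.
have [[-> _]|[n _]] := stepP Jt Js ts; first by rewrite ns.
exact: le_trans n (ltW su).
Unshelve. all: by end_near. Qed.

(** At a reflection [next_time] is the time plus [next_reach], so the unchanged alternative of
    [step] would force [t = u]. *)
Lemma collision23_step t u : J t -> J u ->
  pos m p2 t = 0 -> pos m p2 u = 0 -> t < u ->
  next_time t <= u /\ next_time t + delta <= next_time u.
Proof.
move=> Jt Ju xt xu tu; have [[]|//] := stepP Jt Ju (ltW tu).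
rewrite /next_time xt xu !mulr0 !subr0 => + r; rewrite r => /addIr tu'.
by rewrite tu' ltxx in tu.
Qed.

(** The chain is [t <= next_time t], then [next_time t + delta <= next_time u], then
    [next_time u <= w]. *)
Lemma collision23_gap t u w : J t -> J u -> J w ->
  pos m p2 t = 0 -> pos m p2 u = 0 -> pos m p2 w = 0 ->
  t < u -> u < w -> t + delta <= w.
Proof.
move=> Jt Ju Jw xt xu xw tu uw.
have [_ n1] := collision23_step Jt Ju xt xu tu.
have [n2 _] := collision23_step Ju Jw xu xw uw.
apply: le_trans n2; apply: le_trans n1.
by rewrite lerD2r /next_time xt mulr0 subr0 lerDl reach_ge0.
Qed.

Lemma finite_collision_times a b : finite_set (collision_times J m `&` `[a, b]).
Proof.
pose A12 := [set t | J t /\ pos m p1 t = pos m p2 t].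
pose A23 := [set t | J t /\ pos m p2 t = 0].
have f12 : finite_set (A12 `&` `[a, b]).
  apply: (finite_set_sparse _ _ delta_gt0) => t u w [Jt xt] [Ju xu] _ tu uw.
  exact: le_trans (collision12_gap Jt Ju xt xu tu) (ltW uw).
have f23 : finite_set (A23 `&` `[a, b]).
  apply: (finite_set_sparse _ _ delta_gt0) => t u w [Jt xt] [Ju xu] [Jw xw].
  exact: collision23_gap.
have : finite_set ((A12 `&` `[a, b]) `|` (A23 `&` `[a, b])).
  by rewrite finite_setU.
by apply: sub_finite_set => t [/collision_timesP[Jt [xt|xt]] tab]; [left|right].
Qed.

End Step.

End Mirror.

Theorem mainTheorem2 (R : realType) (mu : R) (J : set R) (m : motion R 4)
    (m_solution : solution J m) (m_mirror : mirror mu J m)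
    (t0 : R) (J_t0 : J t0) (Delta_ge0 : 0 <= half_energy m t0 ^+ 2 - mu) :
  ~ collapses J m /\
  (forall a b : R, finite_set (collision_times J m `&` `[a, b])).
Proof.
have fin := finite_collision_times m_solution m_mirror J_t0.
by split => // -[a [b]]; apply; exact: fin.
Qed.
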